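(* Let $\alpha$ be a nonzero real quaternion. The Euler matrix $E(\alpha)$ is a primitive integral matrix if and only if $\alpha$ belongs to one of the following three types: (1) $\alpha$ is a primitive Lipschitz integral quaternion with odd norm; (2) $\alpha=\beta/\sqrt{2}$, where $\beta$ is a primitive Lipschitz integral quaternion with $N(\beta)\equiv 2 \pmod 4$, equivalently exactly two components of $\beta$ are odd; (3) $\alpha=\beta/2$, where $\beta$ is a primitive Lipschitz integral quaternion with $N(\beta)\equiv 4\pmod 8$, equivalently all four components of $\beta$ are odd. In all cases $N(\alpha)$ is an odd integer, each column and each row of $E(\alpha)$ contains exactly one odd entry, and the number of odd entries in the main diagonal is $3$, $1$, $0$ in types (1), (2), (3) respectively.
   Context: For a quaternion $\alpha=m+ni+pj+qk$ ($m,n,p,q\in\mathbb{R}$), $N(\alpha)=m^2+n^2+p^2+q^2$ and $$E(\alpha)=\begin{pmatrix} m^2+n^2-p^2-q^2 & -2mq+2np & 2mp+2nq\\ 2mq+2np & m^2-n^2+p^2-q^2 & -2mn+2pq\\ -2mp+2nq & 2mn+2pq & m^2-n^2-p^2+q^2\end{pmatrix}.$$ A Lipschitz integral quaternion is one with $m,n,p,q\in\mathbb{Z}$; it is primitive if $\gcd(m,n,p,q)=1$. An integer matrix is primitive if the gcd of its entries is $1$. *)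

(* Defs.v *)
From HB Require Import structures.
From mathcomp Require Import all_boot all_order all_algebra.
From mathcomp Require Import reals.
Set Implicit Arguments. Unset Strict Implicit. Unset Printing Implicit Defensive.
Import Order.TTheory GRing.Theory Num.Theory.
Local Open Scope ring_scope.

(* Quat m n p q stands for m + n i + p j + q k. *)
Record quaternion (R : Type) : Type := Quat { qre : R; qi : R; qj : R; qk : R }.

Definition quat0 (R : pzRingType) : quaternion R := Quat 0 0 0 0.

Definition map_quat (R S : Type) (f : R -> S) (a : quaternion R) : quaternion S :=
  let: Quat m n p q := a in Quat (f m) (f n) (f p) (f q).

Definition quat_div (R : fieldType) (a : quaternion R) (c : R) : quaternion R :=
  map_quat (fun x => x / c) a.

Definition quat_norm (R : pzRingType) (a : quaternion R) : R :=
  let: Quat m n p q := a in m ^+ 2 + n ^+ 2 + p ^+ 2 + q ^+ 2.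

Definition euler_rows (R : pzRingType) (a : quaternion R) : seq (seq R) :=
  let: Quat m n p q := a in
  [:: [:: m ^+ 2 + n ^+ 2 - p ^+ 2 - q ^+ 2;
          - 2 * m * q + 2 * n * p;
          2 * m * p + 2 * n * q];
      [:: 2 * m * q + 2 * n * p;
          m ^+ 2 - n ^+ 2 + p ^+ 2 - q ^+ 2;
          - 2 * m * n + 2 * p * q];
      [:: - 2 * m * p + 2 * n * q;
          2 * m * n + 2 * p * q;
          m ^+ 2 - n ^+ 2 - p ^+ 2 + q ^+ 2]].

Definition euler_mx (R : pzRingType) (a : quaternion R) : 'M[R]_3 :=
  \matrix_(i < 3, j < 3) nth 0 (nth [::] (euler_rows a) i) j.

Definition oddz (z : int) : bool := odd `|z|%N.

(* Lipschitz integral quaternions are the elements of quaternion int, embedded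
   in quaternion R by map_quat intr. *)
Definition lipschitz_primitive (b : quaternion int) : Prop :=
  let: Quat m n p q := b in gcdz (gcdz (gcdz m n) p) q = 1.

Definition odd_components (b : quaternion int) : nat :=
  let: Quat m n p q := b in count oddz [:: m; n; p; q].

Definition mx_primitive (r s : nat) (B : 'M[int]_(r, s)) : Prop :=
  \big[gcdz/0]_(i < r) \big[gcdz/0]_(j < s) B i j = 1.

Definition primitive_integral_mx (R : pzRingType) (r s : nat) (A : 'M[R]_(r, s)) : Prop :=
  exists2 B : 'M[int]_(r, s), A = map_mx intr B & mx_primitive B.

Definition quat_type1 (R : realType) (a : quaternion R) : Prop :=
  exists b : quaternion int,
    [/\ a = map_quat intr b, lipschitz_primitive b & oddz (quat_norm b)].

Definition quat_type2 (R : realType) (a : quaternion R) : Prop :=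
  exists b : quaternion int,
    [/\ a = quat_div (map_quat intr b) (Num.sqrt 2), lipschitz_primitive b
      & (quat_norm b = 2 %[mod 4])%Z].

Definition quat_type3 (R : realType) (a : quaternion R) : Prop :=
  exists b : quaternion int,
    [/\ a = quat_div (map_quat intr b) 2, lipschitz_primitive b
      & (quat_norm b = 4 %[mod 8])%Z].

Definition odd_integer (R : pzRingType) (x : R) : Prop :=
  exists2 z : int, x = z%:~R & oddz z.

Definition one_odd_per_line (r s : nat) (B : 'M[int]_(r, s)) : Prop :=
  (forall j, #|[set i | oddz (B i j)]| = 1%N) /\
  (forall i, #|[set j | oddz (B i j)]| = 1%N).

Definition odd_diagonal (r : nat) (B : 'M[int]_r) : nat := #|[set i | oddz (B i i)]|.

(* Main.v *)
(** For a primitive integral quaternion b, an odd prime dividing all the entries of E(b)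
would divide 4 m^4, 4 n^4, 4 p^4 and 4 q^4, so the content of E(b) is a power of 2.
Writing each component as 2 x + e with e its parity, E(b) is k = 1, 2 or 4 times an
integral matrix with an explicit parity pattern, according to whether an odd number, two
or four of the components of b are odd.  Conversely, if E(a) is integral then a = b / c
with c > 0 and b primitive, so E(a) = (k / c^2) B with B primitive; if E(a) is primitive
too, then c = sqrt k. *)
Require Import Defs.
From mathcomp Require Import all_boot all_order all_algebra.
From mathcomp Require Import reals.
From mathcomp Require Import zify ring.
Set Implicit Arguments. Unset Strict Implicit. Unset Printing Implicit Defensive.
Import Order.TTheory GRing.Theory Num.Theory.
Local Open Scope ring_scope.

(** * Parity of integers and the entries of the Euler matrix *)

Lemma oddzD x y : oddz (x + y) = oddz x (+) oddz y.
Proof. by rewrite /oddz; lia. Qed.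

Lemma oddzN x : oddz (- x) = oddz x.
Proof. by rewrite /oddz abszN. Qed.

Lemma oddzM x y : oddz (x * y) = oddz x && oddz y.
Proof. by rewrite /oddz abszM oddM. Qed.

Lemma oddz1 : oddz 1 = true. Proof. by []. Qed.

Lemma oddz2 : oddz 2 = false. Proof. by []. Qed.

Lemma oddz_halfE x : exists y : int, x = 2 * y + (oddz x)%:Z.
Proof. by exists (x %/ 2)%Z; rewrite /oddz; lia. Qed.

(** Applied twice, this splits a matrix identity into nine scalar goals with explicit indices. *)
Lemma ord3_ind (P : 'I_3 -> Prop) : P 0 -> P 1 -> P 2 -> forall i, P i.
Proof.
move=> P0 P1 P2; case=> [[|[|[|//]]] lti].
- by rewrite (_ : Ordinal lti = 0) //; apply: val_inj.
- by rewrite (_ : Ordinal lti = 1) //; apply: val_inj.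
- by rewrite (_ : Ordinal lti = 2) //; apply: val_inj.
Qed.

Lemma card_set_ord3 (P : pred 'I_3) : #|[set i | P i]| = (P 0%R + P 1%R + P 2%R)%N.
Proof.
rewrite cardsE -sum1_card big_mkcond /= !big_ord_recl big_ord0 /=.
rewrite /in_mem /= addn0 addnA.
rewrite (_ : lift ord0 ord0 = 1); last exact: val_inj.
rewrite (_ : lift ord0 (lift ord0 ord0) = 2); last exact: val_inj.
by do 3!case: (P _).
Qed.

Definition mx3 (T : Type) (x00 x01 x02 x10 x11 x12 x20 x21 x22 : T) : 'M[T]_3 :=
  \matrix_(i, j) nth x00 (nth [::] [:: [:: x00; x01; x02]; [:: x10; x11; x12];
    [:: x20; x21; x22]] i) j.

Lemma euler_mxE (R : pzRingType) (m n p q : R) : euler_mx (Quat m n p q) = mx3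
  (m ^+ 2 + n ^+ 2 - p ^+ 2 - q ^+ 2) (- 2 * m * q + 2 * n * p) (2 * m * p + 2 * n * q)
  (2 * m * q + 2 * n * p) (m ^+ 2 - n ^+ 2 + p ^+ 2 - q ^+ 2) (- 2 * m * n + 2 * p * q)
  (- 2 * m * p + 2 * n * q) (2 * m * n + 2 * p * q) (m ^+ 2 - n ^+ 2 - p ^+ 2 + q ^+ 2).
Proof.
by apply/matrixP; apply: ord3_ind; apply: ord3_ind; rewrite !mxE.
Qed.

Lemma map_quat_intr_norm (R : pzRingType) (b : quaternion int) :
  quat_norm (map_quat intr b : quaternion R) = (quat_norm b)%:~R.
Proof. by case: b => m n p q /=; rewrite !rmorphD !rmorphXn. Qed.

Lemma map_quat_intr_euler (R : comPzRingType) (b : quaternion int) :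
  euler_mx (map_quat intr b : quaternion R) = map_mx intr (euler_mx b).
Proof.
case: b => m n p q; rewrite /map_quat !euler_mxE.
apply/matrixP; apply: ord3_ind; apply: ord3_ind; rewrite !mxE /=; ring.
Qed.

Lemma quat_div_norm (F : fieldType) (a : quaternion F) c :
  quat_norm (quat_div a c) = quat_norm a / c ^+ 2.
Proof. by case: a => m n p q /=; rewrite -exprVn; ring. Qed.

Lemma quat_div_euler (F : fieldType) (a : quaternion F) c :
  euler_mx (quat_div a c) = (c ^+ 2)^-1 *: euler_mx a.
Proof.
case: a => m n p q; rewrite /quat_div /map_quat !euler_mxE -exprVn.
apply/matrixP; apply: ord3_ind; apply: ord3_ind; rewrite !mxE /=; ring.
Qed.

(** * Contents of integer matrices and their prime divisors *)

Lemma big_gcdz_dvd (I : finType) (F : I -> int) i : (\big[gcdz/0]_i F i %| F i)%Z.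
Proof.
have : i \in index_enum I by rewrite mem_index_enum.
elim: (index_enum I) => [//|j s IHs]; rewrite inE big_cons.
case/orP => [/eqP->|/IHs]; first exact: dvdz_gcdl.
by apply: dvdz_trans; apply: dvdz_gcdr.
Qed.

Lemma big_gcdz_mull (I : finType) (F : I -> int) (x : int) : 0 <= x ->
  \big[gcdz/0]_i (x * F i) = x * \big[gcdz/0]_i F i.
Proof.
move=> x_ge0; apply/esym/(big_morph ( *%R x)); last exact: mulr0.
by move=> y z; rewrite -mulz_gcdr gez0_abs.
Qed.

(** The content divides an odd entry, so it is odd and nonzero; were it not 1, its least prime
    factor would be an odd prime dividing every entry. *)
Lemma mx_primitive_prime r s (B : 'M[int]_(r, s)) i0 j0 : oddz (B i0 j0) ->
  (forall l : nat, prime l -> odd l -> ~ (forall i j, (l %| B i j)%Z)) ->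
  mx_primitive B.
Proof.
rewrite /mx_primitive; set d := \big[gcdz/0]_i _ => oddB noprime.
have dB i j : (d %| B i j)%Z.
  by apply: dvdz_trans (big_gcdz_dvd (B i) j); apply: big_gcdz_dvd.
have d_ge0 : 0 <= d.
  by rewrite /d; elim/big_rec: _ => // i x _ _; rewrite /gcdz.
have odd_d : odd `|d|%N.
  by have := dB i0 j0; rewrite dvdzE => /dvdn_odd; apply.
have [|d_neq1] := eqVneq `|d|%N 1%N; first by lia.
have d_gt0 : (1 < `|d|)%N by case: `|d|%N odd_d d_neq1 => [|[]].
case: (noprime (pdiv `|d|%N)) => [||i j]; first exact: pdiv_prime.
  exact: dvdn_odd (pdiv_dvd _) odd_d.
by have := dB i j; rewrite !dvdzE; apply: dvdn_trans; apply: pdiv_dvd.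
Qed.

Lemma lipschitz_primitive_dvd m n p q (l : int) : lipschitz_primitive (Quat m n p q) ->
  (l %| m)%Z -> (l %| n)%Z -> (l %| p)%Z -> (l %| q)%Z -> (l %| 1)%Z.
Proof.
move=> b_prim lm ln lp lq; have : (l %| gcdz (gcdz (gcdz m n) p) q)%Z.
  by rewrite !dvdz_gcd lm ln lp lq.
by rewrite [gcdz _ _]b_prim.
Qed.

Lemma dvdz_prime_pow4 (l : nat) (x : int) : prime l -> odd l ->
  (l %| 4 * x ^+ 4)%Z -> (l %| x)%Z.
Proof.
move=> l_pr l_odd; rewrite !dvdzE abszM abszX (@Gauss_dvdr _ 4).
  by rewrite Euclid_dvdX // => /andP[].
by rewrite (@coprime_pexpr 2 _ 2) // coprimen2.
Qed.

Lemma euler_mx_prime b (l : nat) : lipschitz_primitive b -> prime l -> odd l ->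
  ~ (forall i j, (l %| euler_mx b i j)%Z).
Proof.
case: b => m n p q b_prim l_pr l_odd lE.
suff: (l %| 1)%Z by rewrite dvdzE dvdn1 => /eqP /= l1; rewrite l1 in l_pr.
(* A sum of two diagonal entries is twice a difference of two squares, such as
   [2 * (m ^+ 2 - n ^+ 2)], and the difference of the two opposite entries is four times a product,
   such as [4 * m * n]. The multipliers [v] and [w] cancel the mixed terms and leave a fourth
   power. *)
have lD (x y z t u v w : int) : (l %| x)%Z -> (l %| y)%Z -> (l %| z)%Z -> (l %| t)%Z ->
    4 * u ^+ 4 = v * (x + y) + w * (z - t) -> (l %| u)%Z.
  move=> lx ly lz lt E; apply: dvdz_prime_pow4 => //; rewrite E.
  by rewrite rpredD // dvdz_mull // rpredD ?rpredN.
move: lE; rewrite euler_mxE => lE.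
apply: (lipschitz_primitive_dvd b_prim).
- apply: (lD _ _ _ _ _ (2 * m ^+ 2) (m * n) (lE 1 1) (lE 2 2) (lE 2 1) (lE 1 2)).
  by rewrite !mxE /=; ring.
- apply: (lD _ _ _ _ _ (- 2 * n ^+ 2) (m * n) (lE 1 1) (lE 2 2) (lE 2 1) (lE 1 2)).
  by rewrite !mxE /=; ring.
- apply: (lD _ _ _ _ _ (- 2 * p ^+ 2) (m * p) (lE 0 0) (lE 2 2) (lE 0 2) (lE 2 0)).
  by rewrite !mxE /=; ring.
- apply: (lD _ _ _ _ _ (- 2 * q ^+ 2) (m * q) (lE 0 0) (lE 1 1) (lE 1 0) (lE 0 1)).
  by rewrite !mxE /=; ring.
Qed.

(** * The norm modulo 4 and 8 and the number of odd components *)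

Lemma sqr_oddzE x :
  exists2 y : int, x ^+ 2 = 4 * y + (oddz x)%:Z & oddz x -> ~~ oddz y.
Proof.
(* For odd [x = 2 * y + 1] the quotient is [y * (y + 1)], a product of consecutive integers and
   hence even: odd squares are 1 modulo 8. *)
have [y xE] := oddz_halfE x; exists (y * (y + (oddz x)%:Z)).
  by rewrite [in LHS]xE; case: (oddz x) => /=; ring.
by move=> ->; rewrite oddzM oddzD; case: (oddz y).
Qed.

(** Each odd square contributes 1 modulo 4. If all four components are odd, the four quotients are
    even, which refines the congruence to modulo 8. *)
Lemma odd_components_norm b :
  exists2 x : int, quat_norm b = 4 * x + (odd_components b)%:Z
    & odd_components b = 4%N -> ~~ oddz x.
Proof.
case: b => m n p q /=.
have [xm -> om] := sqr_oddzE m; have [xn -> on] := sqr_oddzE n.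
have [xp -> op] := sqr_oddzE p; have [xq -> oq] := sqr_oddzE q.
exists (xm + xn + xp + xq); first by rewrite addn0 !PoszD; ring.
move=> b4; have [/om hm /on hn /op hp /oq hq] : [/\ oddz m, oddz n, oddz p & oddz q].
  by move: b4; do 4!case: (oddz _).
by rewrite !oddzD !negb_add (negbTE hm) (negbTE hn) (negbTE hp) (negbTE hq).
Qed.

Lemma odd_components_le4 b : (odd_components b <= 4)%N.
Proof. by case: b => m n p q /=; do 4!case: (oddz _). Qed.

Lemma odd_components_gt0 b : lipschitz_primitive b -> (0 < odd_components b)%N.
Proof.
case: b => m n p q b_prim; rewrite lt0n; apply/negP => b0.
suff: (2 %| 1)%Z by [].
have even_dvd x : oddz x = false -> (2 %| x)%Z by rewrite /oddz; lia.
move: b0 => /=; rewrite !addn_eq0 !eqb0.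
move=> /and5P[/negbTE m0 /negbTE n0 /negbTE p0 /negbTE q0 _].
by apply: (lipschitz_primitive_dvd b_prim); apply: even_dvd.
Qed.

Lemma norm_mod4_odd_components b :
  (quat_norm b = 2 %[mod 4])%Z <-> odd_components b = 2%N.
Proof.
have [x -> _] := odd_components_norm b; have := odd_components_le4 b.
by split; lia.
Qed.

(** A norm divisible by 4 forces 0 or 4 odd components, and primitivity excludes 0. Conversely, four
    odd squares add up to 4 modulo 8. *)
Lemma norm_mod8_odd_components b : lipschitz_primitive b ->
  (quat_norm b = 4 %[mod 8])%Z <-> odd_components b = 4%N.
Proof.
have [x -> ox] := odd_components_norm b; have := odd_components_le4 b.
move=> b4 /odd_components_gt0 b0; split; first by lia.
by move=> b4E; move: ox; rewrite b4E => /(_ erefl); rewrite /oddz; lia.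
Qed.

Lemma oddz_norm_odd_components b : oddz (quat_norm b) = odd (odd_components b).
Proof. by have [x -> _] := odd_components_norm b; rewrite /oddz; lia. Qed.

(** * Extracting the factor 1, 2 or 4 from the Euler matrix of a primitive quaternion *)

Lemma parity_odd_diagonal (B : 'M[int]_3) : odd_diagonal B =
  (oddz (B 0%R 0%R) + oddz (B 1%R 1%R) + oddz (B 2%R 2%R))%N.
Proof. exact: card_set_ord3. Qed.

(* E(b) = k B and N(b) = k N, so that E(b / sqrt k) = B and N(b / sqrt k) = N. *)
Definition euler_reduction (b : quaternion int) (k : int) (B : 'M[int]_3) (N : int) d :=
  [/\ euler_mx b = k *: B /\ quat_norm b = k * N, oddz N, mx_primitive B,
      one_odd_per_line B & odd_diagonal B = d].

(* An odd entry of B kills the powers of 2 in its content, and odd primes are excluded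
   by euler_mx_prime. *)
Lemma euler_reductionI b k B N d : lipschitz_primitive b ->
  euler_mx b = k *: B -> quat_norm b = k * N -> oddz N ->
  one_odd_per_line B -> odd_diagonal B = d -> euler_reduction b k B N d.
Proof.
move=> b_prim EB NE oN oB dB; split=> //.
have /card_gt0P[i] : (0 < #|[set i | oddz (B i 0%R)]|)%N by rewrite oB.1.
rewrite inE => oBi; apply: (mx_primitive_prime oBi) => l l_pr l_odd lB.
apply: (euler_mx_prime b_prim l_pr l_odd) => i' j'.
by rewrite EB mxE dvdz_mull.
Qed.

(** Modulo 2 the off-diagonal entries vanish and each diagonal entry equals the norm, so the matrix
    reduces to the identity. *)
Lemma euler_reduction_odd b : lipschitz_primitive b -> odd (odd_components b) ->
  euler_reduction b 1 (euler_mx b) (quat_norm b) 3.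
Proof.
move=> b_prim; rewrite -oddz_norm_odd_components => oN.
apply: euler_reductionI; rewrite ?scale1r ?mul1r //.
all: case: b {b_prim} oN => m n p q; rewrite euler_mxE /= !(oddzD, oddzN, oddzM) => oN.
  split; apply: ord3_ind; rewrite card_set_ord3 !mxE /= !(oddzD, oddzN, oddzM) /=;
  by move: oN; do 4!case: (oddz _).
rewrite parity_odd_diagonal !mxE /= !(oddzD, oddzN, oddzM).
by move: oN; do 4!case: (oddz _).
Qed.

(** Exactly one of the three splittings of the components into two pairs puts both odd ones in the
    same pair. It selects one odd diagonal entry and the two odd opposite entries outside its row
    and column: modulo 2, [B] is the permutation matrix of a transposition. *)
Lemma euler_reduction2 b : lipschitz_primitive b -> odd_components b = 2%N ->
  exists B N, euler_reduction b 2 B N 1.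
Proof.
case: b => m n p q b_prim /= b2.
have [m' mE] := oddz_halfE m; have [n' nE] := oddz_halfE n.
have [p' pE] := oddz_halfE p; have [q' qE] := oddz_halfE q.
(* The parities become free booleans, so that a case analysis leaves six polynomial identities. *)
move: (oddz m) (oddz n) (oddz p) (oddz q) mE nE pE qE b2 => em en ep eq mE nE pE qE b2.
(* When exactly two of the bits are set, h is half of e1 + e2 - e3 - e4. *)
pose h (e1 e2 e3 e4 : bool) := (e1 && e2)%:Z - (e3 && e4)%:Z.
pose B := mx3
  (2 * (m' * (m' + em%:Z) + n' * (n' + en%:Z) - p' * (p' + ep%:Z) - q' * (q' + eq%:Z))
     + h em en ep eq)
  (n * p - m * q) (m * p + n * q)
  (m * q + n * p)
  (2 * (m' * (m' + em%:Z) - n' * (n' + en%:Z) + p' * (p' + ep%:Z) - q' * (q' + eq%:Z))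
     + h em ep en eq)
  (p * q - m * n) (n * q - m * p) (m * n + p * q)
  (2 * (m' * (m' + em%:Z) - n' * (n' + en%:Z) - p' * (p' + ep%:Z) + q' * (q' + eq%:Z))
     + h em eq en ep).
pose N :=
  2 * (m' * (m' + em%:Z) + n' * (n' + en%:Z) + p' * (p' + ep%:Z) + q' * (q' + eq%:Z)) + 1.
exists B, N; apply: euler_reductionI => //; rewrite ?euler_mxE /B /N /h.
- apply/matrixP; apply: ord3_ind; apply: ord3_ind; rewrite !mxE /= ?mE ?nE ?pE ?qE;
  by case: em en ep eq b2 {mE nE pE qE B N} => [] [] [] [] //= _; ring.
- rewrite /= mE nE pE qE.
  by case: em en ep eq b2 {mE nE pE qE B N} => [] [] [] [] //= _; ring.
- by case: em en ep eq b2 {mE nE pE qE B N} => [] [] [] [] //= _;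
    rewrite !(oddzD, oddzN, oddzM).
- split; apply: ord3_ind; rewrite card_set_ord3 !mxE /= ?mE ?nE ?pE ?qE;
  by case: em en ep eq b2 {mE nE pE qE B N} => [] [] [] [] //= _;
    rewrite !(oddzD, oddzN, oddzM) /= ?andbF ?addbF.
rewrite parity_odd_diagonal !mxE /=;
  by case: em en ep eq b2 {mE nE pE qE B N} => [] [] [] [] //= _;
    rewrite !(oddzD, oddzN, oddzM).
Qed.

(** The diagonal of [B] combines products of consecutive integers, hence is even. Since [s x y] is
    [x + y] modulo 2, each off-diagonal entry has the parity of [m' + n' + p' + q'] or the opposite
    one, so [B] reduces to the permutation matrix of a 3-cycle. *)
Lemma euler_reduction4 b : lipschitz_primitive b -> odd_components b = 4%N ->
  exists B N, euler_reduction b 4 B N 0.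
Proof.
case: b => m n p q b_prim /= b4.
have [m' mE] := oddz_halfE m; have [n' nE] := oddz_halfE n.
have [p' pE] := oddz_halfE p; have [q' qE] := oddz_halfE q.
have [om [on [op oq]]] : oddz m /\ oddz n /\ oddz p /\ oddz q.
  by move: b4; do 4!case: (oddz _).
rewrite om on op oq {b4 om on op oq} in mE nE pE qE.
(* Chosen so that [(2 * x + 1) * (2 * y + 1) = 2 * s x y + 1]. *)
pose s (x y : int) := x + y + 2 * x * y.
pose B := mx3
  (m' * (m' + 1) + n' * (n' + 1) - p' * (p' + 1) - q' * (q' + 1))
  (s n' p' - s m' q') (s m' p' + s n' q' + 1)
  (s m' q' + s n' p' + 1)
  (m' * (m' + 1) - n' * (n' + 1) + p' * (p' + 1) - q' * (q' + 1))
  (s p' q' - s m' n') (s n' q' - s m' p') (s m' n' + s p' q' + 1)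
  (m' * (m' + 1) - n' * (n' + 1) - p' * (p' + 1) + q' * (q' + 1)).
pose N := m' * (m' + 1) + n' * (n' + 1) + p' * (p' + 1) + q' * (q' + 1) + 1.
exists B, N; apply: euler_reductionI => //; rewrite ?euler_mxE /B /N /s.
- by apply/matrixP; apply: ord3_ind; apply: ord3_ind; rewrite !mxE /= mE nE pE qE /=; ring.
- by rewrite /= mE nE pE qE /=; ring.
- by rewrite !(oddz2, oddz1, oddzD, oddzN, oddzM); do 4!case: (oddz _).
- by split; apply: ord3_ind; rewrite card_set_ord3 !mxE /= !(oddz2, oddz1, oddzD, oddzN, oddzM) /=;
    do 4!case: (oddz _).
by rewrite parity_odd_diagonal !mxE /= !(oddz2, oddz1, oddzD, oddzN, oddzM); do 4!case: (oddz _).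
Qed.

(** * The three types have primitive integral Euler matrices *)

Lemma euler_reduction_div (R : realType) b k B N d (s : R) :
  euler_reduction b k B N d -> k != 0 -> s ^+ 2 = k%:~R ->
  let a := quat_div (map_quat intr b) s in
  quat_norm a = N%:~R /\ euler_mx a = map_mx intr B.
Proof.
move=> [[EB NE] _ _ _ _] k_neq0 sE /=.
have kR_neq0 : (k%:~R : R) != 0 by rewrite intr_eq0.
(* Norm and Euler matrix are quadratic, so dividing the components by [s] divides both by
   [s ^+ 2 = k]. *)
rewrite quat_div_norm map_quat_intr_norm quat_div_euler map_quat_intr_euler sE EB NE.
split; first by rewrite intrM mulrC mulKf.
by apply/matrixP => i j; rewrite !mxE intrM mulKf.
Qed.

Definition euler_normal (R : realType) (a : quaternion R) d (B : 'M[int]_3) :=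
  [/\ euler_mx a = map_mx intr B, mx_primitive B, one_odd_per_line B,
      odd_diagonal B = d & odd_integer (quat_norm a)].

Lemma euler_reduction_normal (R : realType) b k B N d (s : R) :
  euler_reduction b k B N d -> k != 0 -> s ^+ 2 = k%:~R ->
  euler_normal (quat_div (map_quat intr b) s) d B.
Proof.
move=> redB k_neq0 sE; have [NE EE] := euler_reduction_div redB k_neq0 sE.
by have [_ oN pB oB dB] := redB; split=> //; exists N.
Qed.

(** Makes type 1 the case [k = s = 1] of [euler_reduction_normal]. *)
Lemma quat_div1 (R : fieldType) (a : quaternion R) : quat_div a 1 = a.
Proof. by case: a => m n p q; rewrite /quat_div /map_quat !divr1. Qed.

Lemma quat_type1_normal (R : realType) (a : quaternion R) :
  quat_type1 a -> exists B, euler_normal a 3 B.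
Proof.
case=> b [-> b_prim]; rewrite oddz_norm_odd_components => ob.
exists (euler_mx b); rewrite -[map_quat _ _]quat_div1.
by apply: euler_reduction_normal (euler_reduction_odd b_prim ob) _ _; rewrite ?expr1n.
Qed.

Lemma sqr_sqrt2 (R : realType) : (Num.sqrt 2 : R) ^+ 2 = 2%:~R.
Proof. exact: sqr_sqrtr. Qed.

Lemma quat_type2_normal (R : realType) (a : quaternion R) :
  quat_type2 a -> exists B, euler_normal a 1 B.
Proof.
case=> b [-> b_prim /norm_mod4_odd_components b2].
have [B [N redB]] := euler_reduction2 b_prim b2; exists B.
exact: euler_reduction_normal redB _ (sqr_sqrt2 R).
Qed.

Lemma quat_type3_normal (R : realType) (a : quaternion R) :
  quat_type3 a -> exists B, euler_normal a 0 B.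
Proof.
case=> b [-> b_prim /(norm_mod8_odd_components b_prim) b4].
have [B [N redB]] := euler_reduction4 b_prim b4; exists B.
by apply: euler_reduction_normal redB _ _ => //; rewrite -natrX.
Qed.

Lemma quat_type_normal (R : realType) (a : quaternion R) :
  [\/ quat_type1 a, quat_type2 a | quat_type3 a] -> exists d B, euler_normal a d B.
Proof.
by case=> [/quat_type1_normal|/quat_type2_normal|/quat_type3_normal] ?;
  eexists; eassumption.
Qed.

(** * Proportional primitive matrices *)

Lemma map_intr_inj (R : realType) r s :
  injective (map_mx intr : 'M[int]_(r, s) -> 'M[R]_(r, s)).
Proof.
by move=> A B /matrixP AB; apply/matrixP => i j; have := AB i j; rewrite !mxE => /intr_inj.
Qed.

Lemma mx_content_mull r s (B : 'M[int]_(r, s)) (x : int) : 0 <= x ->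
  \big[gcdz/0]_(i < r) \big[gcdz/0]_(j < s) (x * B i j) =
  x * \big[gcdz/0]_(i < r) \big[gcdz/0]_(j < s) B i j.
Proof.
move=> x_ge0; rewrite -big_gcdz_mull //.
by apply: eq_bigr => i _; rewrite big_gcdz_mull.
Qed.

Lemma mx_primitive_neq0 r s (B : 'M[int]_(r, s)) :
  mx_primitive B -> exists i j, B i j != 0.
Proof.
move=> pB; have [/existsP[i /existsP[j Bij]]|/existsPn B0] :=
  boolP [exists i, exists j, B i j != 0]; first by exists i, j.
(* A zero matrix is unchanged when scaled by 0, so its content would be both 1 and 0. *)
have := mx_content_mull B (lexx 0); rewrite mul0r -[RHS]add0r.
rewrite (eq_bigr (fun i => \big[gcdz/0]_(j < s) B i j)) => [|i _].
  by rewrite [LHS]pB.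
apply: eq_bigr => j _; rewrite mul0r.
by have /existsPn/(_ j) := B0 i; rewrite negbK => /eqP.
Qed.

(** At a nonzero entry of [B'], [t] is a ratio of two absolute values. Clearing the denominator
    gives an identity between integer multiples of [B] and [B']; comparing contents makes the two
    multipliers equal. *)
Lemma mx_primitive_scale (R : realType) r s (B B' : 'M[int]_(r, s)) (t : R) :
  0 < t -> mx_primitive B -> mx_primitive B' ->
  map_mx intr B = t *: map_mx intr B' -> t = 1.
Proof.
move=> t_gt0 pB pB' BE; have [i [j B'ij]] := mx_primitive_neq0 pB'.
have BEij i' j' : (B i' j')%:~R = t * (B' i' j')%:~R.
  by have /matrixP/(_ i' j') := BE; rewrite !mxE.
have B'R : (`|B' i j|%:~R : R) != 0 by rewrite intr_eq0 normr_eq0.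
have tE : `|B i j|%:~R = t * `|B' i j|%:~R.
  by rewrite !intr_norm BEij normrM gtr0_norm.
have scaleE i' j' : `|B' i j| * B i' j' = `|B i j| * B' i' j'.
  by apply: (@intr_inj R); rewrite !intrM tE BEij; ring.
have := mx_content_mull B (normr_ge0 (B' i j)).
rewrite (eq_bigr (fun i' => \big[gcdz/0]_(j' < s) (`|B i j| * B' i' j'))) => [|i' _].
  rewrite mx_content_mull // [X in _ * X]pB' [X in _ = _ * X]pB !mulr1 => xy.
  by apply: (mulIf B'R); rewrite -tE xy mul1r.
by apply: eq_bigr => j' _; rewrite scaleE.
Qed.

(** * From an integral Euler matrix to a primitive integral quaternion *)

Lemma int_quat_primitive (m n p q : int) : Quat m n p q <> quat0 int ->
  exists g m' n' p' q', [/\ 0 < g, lipschitz_primitive (Quat m' n' p' q')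
    & Quat m n p q = map_quat ( *%R g) (Quat m' n' p' q')].
Proof.
move=> v_neq0; pose g := gcdz (gcdz (gcdz m n) p) q.
have [gq gp gn gm] : [/\ (g %| q)%Z, (g %| p)%Z, (g %| n)%Z & (g %| m)%Z].
  have := dvdzz g; rewrite {2}/g !dvdz_gcd => /andP[/andP[/andP[]]].
  by split.
have g_ge0 : 0 <= g by [].
have g_gt0 : 0 < g.
  rewrite lt0r g_ge0 andbT; apply/eqP => g0; apply: v_neq0; move: gq gp gn gm.
  by rewrite g0 !dvd0z => /eqP-> /eqP-> /eqP-> /eqP->.
exists g, (m %/ g)%Z, (n %/ g)%Z, (p %/ g)%Z, (q %/ g)%Z; split=> //; last first.
  by rewrite /map_quat ![g * _]mulrC !divzK.
rewrite /lipschitz_primitive; apply: (@mulfI _ g); first by rewrite gt_eqF.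
have gM x y : g * gcdz x y = gcdz (g * x) (g * y) by rewrite -mulz_gcdr gez0_abs.
by rewrite !gM ![g * _]mulrC !divzK // mul1r.
Qed.

(* E(a) E(a)^T = N(a)^2 and det E(a) = N(a)^3, so N(a) is rational; then so are all the
   products of two components of a, and a is proportional to a rational quaternion. *)
Lemma euler_integral_primitive (R : realType) (a : quaternion R) (B : 'M[int]_3) :
  a <> quat0 R -> euler_mx a = map_mx intr B ->
  exists c b, [/\ 0 < c, lipschitz_primitive b & a = quat_div (map_quat intr b) c].
Proof.
case: a => m n p q a_neq0; rewrite euler_mxE => /matrixP EB.
pose N := m ^+ 2 + n ^+ 2 + p ^+ 2 + q ^+ 2.
have N_neq0 : N != 0.
  apply/eqP => /eqP; rewrite !paddr_eq0 ?addr_ge0 ?sqr_ge0 // !sqrf_eq0.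
  move=> /andP[/andP[/andP[/eqP m0 /eqP n0] /eqP p0] /eqP q0].
  by apply: a_neq0; rewrite m0 n0 p0 q0.
have E00 := EB 0 0; have E01 := EB 0 1; have E02 := EB 0 2.
have E10 := EB 1 0; have E11 := EB 1 1; have E12 := EB 1 2.
have E20 := EB 2 0; have E21 := EB 2 1; have E22 := EB 2 2.
rewrite !mxE /= in E00 E01 E02 E10 E11 E12 E20 E21 E22.
move: (B 0 0) (B 0 1) (B 0 2) (B 1 0) (B 1 1) (B 1 2) (B 2 0) (B 2 1) (B 2 2)
  E00 E01 E02 E10 E11 E12 E20 E21 E22 =>
  b00 b01 b02 b10 b11 b12 b20 b21 b22 E00 E01 E02 E10 E11 E12 E20 E21 E22 {EB}.
(* The squared length of the first row and the determinant, which are the square and the cube of the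
   norm. *)
pose D2 := b00 ^+ 2 + b01 ^+ 2 + b02 ^+ 2.
pose D3 := b00 * (b11 * b22 - b12 * b21) - b01 * (b10 * b22 - b12 * b20)
  + b02 * (b10 * b21 - b11 * b20).
have D2E : D2%:~R = N ^+ 2.
  by rewrite !rmorphD !rmorphXn /= -E00 -E01 -E02 /N; ring.
have D3E : D3%:~R = N ^+ 3.
  rewrite !(rmorphD, rmorphN, rmorphM) /= -E00 -E01 -E02 -E10 -E11 -E12 -E20 -E21 -E22.
  by rewrite /N; ring.
move: D2 D3 D2E D3E => D2 D3 D2E D3E.
pose isint (x : R) := exists z : int, x = z%:~R.
(* Signed sums of the diagonal entries and [N] give four times the squares of the components; the
   factor [N ^+ 2] turns [N] into the integer [D3] and the entries into multiples of [D2]. *)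
pose k := 4 * N ^+ 2.
have k_neq0 : k != 0 by rewrite mulf_neq0 ?sqrf_eq0 // pnatr_eq0.
have kmm : isint (k * m * m).
  exists (D3 + D2 * (b00 + b11 + b22)); rewrite !(rmorphD, rmorphM) /=.
  by rewrite D2E D3E -E00 -E11 -E22 /k /N; ring.
have knn : isint (k * n * n).
  exists (D3 + D2 * (b00 - b11 - b22)); rewrite !(rmorphD, rmorphN, rmorphM) /=.
  by rewrite D2E D3E -E00 -E11 -E22 /k /N; ring.
have kpp : isint (k * p * p).
  exists (D3 + D2 * (b11 - b00 - b22)); rewrite !(rmorphD, rmorphN, rmorphM) /=.
  by rewrite D2E D3E -E00 -E11 -E22 /k /N; ring.
have kqq : isint (k * q * q).
  exists (D3 + D2 * (b22 - b00 - b11)); rewrite !(rmorphD, rmorphN, rmorphM) /=.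
  by rewrite D2E D3E -E00 -E11 -E22 /k /N; ring.
have kmn : isint (k * m * n).
  by exists (D2 * (b21 - b12)); rewrite rmorphM rmorphB /= D2E -E21 -E12 /k; ring.
have kmp : isint (k * m * p).
  by exists (D2 * (b02 - b20)); rewrite rmorphM rmorphB /= D2E -E02 -E20 /k; ring.
have kmq : isint (k * m * q).
  by exists (D2 * (b10 - b01)); rewrite rmorphM rmorphB /= D2E -E10 -E01 /k; ring.
have knp : isint (k * n * p).
  by exists (D2 * (b01 + b10)); rewrite rmorphM rmorphD /= D2E -E10 -E01 /k; ring.
have knq : isint (k * n * q).
  by exists (D2 * (b02 + b20)); rewrite rmorphM rmorphD /= D2E -E02 -E20 /k; ring.
have kpq : isint (k * p * q).
  by exists (D2 * (b12 + b21)); rewrite rmorphM rmorphD /= D2E -E12 -E21 /k; ring.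
have isintN x : isint x -> isint (- x) by move=> [z ->]; exists (- z); rewrite rmorphN.
(* The scale is [k] times a nonzero component, so the scaled components are among the integral
   products above. *)
have [s s_neq0 [sm sn sp sq]] : exists2 s : R, s != 0 &
    [/\ isint (s * m), isint (s * n), isint (s * p) & isint (s * q)].
  have [m0|m_neq0] := eqVneq m 0; last first.
    by exists (k * m); [apply: mulf_neq0 | split].
  have [n0|n_neq0] := eqVneq n 0; last first.
    by exists (k * n); [apply: mulf_neq0 | split; rewrite // mulrAC].
  have [p0|p_neq0] := eqVneq p 0; last first.
    by exists (k * p); [apply: mulf_neq0 | split; rewrite // mulrAC].
  have [q0|q_neq0] := eqVneq q 0; last first.
    by exists (k * q); [apply: mulf_neq0 | split; rewrite // mulrAC].
  by case: a_neq0; rewrite m0 n0 p0 q0.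
have {s s_neq0 sm sn sp sq} [s s_gt0 [[m1 sm] [n1 sn] [p1 sp] [q1 sq]]] :
    exists2 s : R, 0 < s &
    [/\ isint (s * m), isint (s * n), isint (s * p) & isint (s * q)].
  move: s_neq0; rewrite neq_lt => /orP[s_lt0|s_gt0]; last by exists s.
  by exists (- s); rewrite ?oppr_gt0 // !mulNr; split; apply: isintN.
have s_neq0 : s != 0 by rewrite gt_eqF.
have [|g [m' [n' [p' [q' [g_gt0 b_prim [m1E n1E p1E q1E]]]]]]] :=
    @int_quat_primitive m1 n1 p1 q1.
  case=> m10 n10 p10 q10; apply: a_neq0; move: sm sn sp sq; rewrite m10 n10 p10 q10.
  have s0 x : s * x = 0%:~R -> x = 0.
    by move=> sx; apply: (mulfI s_neq0); rewrite sx mulr0.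
  by move=> /s0-> /s0-> /s0-> /s0->.
have gR_gt0 : 0 < g%:~R :> R by rewrite ltr0z.
(* Here [s] times the quaternion is integral with content [g], whence the divisor [s / g]. *)
exists (s / g%:~R), (Quat m' n' p' q'); split=> //; first by rewrite divr_gt0.
rewrite /quat_div /map_quat !invf_div.
suff E x x' : s * x = (g * x')%:~R -> x = x'%:~R * (g%:~R / s).
  by congr Quat; apply: E; rewrite -?m1E -?n1E -?p1E -?q1E.
by rewrite intrM => sx; apply: (mulfI s_neq0); rewrite sx; field.
Qed.

(** * Classification and conclusion *)

Lemma primitive_euler_type (R : realType) (a : quaternion R) :
  a <> quat0 R -> primitive_integral_mx (euler_mx a) ->
  [\/ quat_type1 a, quat_type2 a | quat_type3 a].
Proof.
move=> a_neq0 [B EB pB].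
have [c [b [c_gt0 b_prim aE]]] := euler_integral_primitive a_neq0 EB.
(* The Euler matrix of [a] is [k / c ^+ 2] times the primitive [B'] and is itself primitive, so the
   ratio is 1; positivity of [c] fixes the square root. *)
have cE k B' N d : 0 < k -> euler_reduction b k B' N d -> c = Num.sqrt k%:~R.
  move=> k_gt0 [[EB' _] _ pB' _ _].
  have kR_gt0 : 0 < k%:~R :> R by rewrite ltr0z.
  have c2_gt0 : 0 < c ^+ 2 by rewrite exprn_gt0.
  have : k%:~R / c ^+ 2 = 1.
    apply: (mx_primitive_scale _ pB pB'); first by rewrite divr_gt0.
    rewrite -EB aE quat_div_euler map_quat_intr_euler EB'.
    by apply/matrixP => i j; rewrite !mxE intrM mulrA [_^-1 * _]mulrC.
  by move/divr1_eq => ->; rewrite sqrtr_sqr gtr0_norm.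
have := odd_components_gt0 b_prim; have := odd_components_le4 b.
have [ob _ _|] := boolP (odd (odd_components b)).
  apply: Or31; exists b; split=> //; last by rewrite oddz_norm_odd_components.
  rewrite aE (cE _ _ _ _ _ (euler_reduction_odd b_prim ob)) //.
  by rewrite sqrtr1 quat_div1.
(* An even count between 1 and 4 is 2 or 4. *)
case b2: (odd_components b) => [|[|[|[|[|//]]]]] // _ _ _.
  apply: Or32; exists b; split=> //; last exact/norm_mod4_odd_components.
  have [B' [N red]] := euler_reduction2 b_prim b2.
  by rewrite aE (cE _ _ _ _ _ red).
apply: Or33; exists b; split=> //; last exact/norm_mod8_odd_components.
have [B' [N red]] := euler_reduction4 b_prim b2.
rewrite aE (cE _ _ _ _ _ red) //; congr quat_div.
by rewrite (_ : 4%:~R = 2 ^+ 2) ?sqrtr_sqr ?ger0_norm // -natrX.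
Qed.

Theorem theorem3p3 (R : realType) (a : quaternion R) (a_neq0 : a <> quat0 R) :
  [/\ primitive_integral_mx (euler_mx a) <->
        [\/ quat_type1 a, quat_type2 a | quat_type3 a],
      forall b : quaternion int, lipschitz_primitive b ->
        ((quat_norm b = 2 %[mod 4])%Z <-> odd_components b = 2%N),
      forall b : quaternion int, lipschitz_primitive b ->
        ((quat_norm b = 4 %[mod 8])%Z <-> odd_components b = 4%N)
    & [\/ quat_type1 a, quat_type2 a | quat_type3 a] ->
        odd_integer (quat_norm a) /\
        exists B : 'M[int]_3,
          [/\ euler_mx a = map_mx intr B,
              one_odd_per_line B,
              quat_type1 a -> odd_diagonal B = 3%N,
              quat_type2 a -> odd_diagonal B = 1%N
            & quat_type3 a -> odd_diagonal B = 0%N]].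
Proof.
split.
- split; first exact: primitive_euler_type.
  by move=> /quat_type_normal[d [B [EB pB _ _ _]]]; exists B.
- by move=> b _; apply: norm_mod4_odd_components.
- exact: norm_mod8_odd_components.
move=> /quat_type_normal[d [B [EB _ oB _ oN]]]; split=> //.
(* Integer matrices embed injectively into real ones, so the matrix supplied by any type that holds
   is [B] itself, and its diagonal count is that of [B]. *)
have same_diagonal d' : (exists B', euler_normal a d' B') -> odd_diagonal B = d'.
  case=> B' [EB' _ _ <- _]; congr odd_diagonal.
  by apply: (@map_intr_inj R); rewrite -EB.
exists B; split=> // ?; apply: same_diagonal.
- exact: quat_type1_normal.
- exact: quat_type2_normal.
exact: quat_type3_normal.
Qed.
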